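(* Let $\alpha$ and $\beta$ be integers with $\alpha\neq 1$ and $\beta\neq 1$, and let $$G(\alpha,\beta)=\langle A,B\mid A^{[A,B]}=A^{\alpha},\ B^{[B,A]}=B^{\beta}\rangle .$$ Then the group $G(\alpha,\beta)$ is nilpotent.
   Context: Conventions: $[x,y]=x^{-1}y^{-1}xy$ and $y^x=x^{-1}yx$, so $A^{[A,B]}=[A,B]^{-1}A[A,B]$. *)

(* Defs.v *)
From Stdlib Require Import ZArith List.
Import ListNotations.

Record Group := {
  carrier :> Type;
  gmul : carrier -> carrier -> carrier;
  ginv : carrier -> carrier;
  gone : carrier;
  gmul_assoc : forall x y z, gmul x (gmul y z) = gmul (gmul x y) z;
  gmul_1l : forall x, gmul gone x = x;
  gmul_1r : forall x, gmul x gone = x;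
  gmul_Vl : forall x, gmul (ginv x) x = gone;
  gmul_Vr : forall x, gmul x (ginv x) = gone
}.

Section Ops.
Variable G : Group.

Fixpoint gpow_nat (x : G) (n : nat) : G :=
  match n with
  | O => gone G
  | S n => gmul G x (gpow_nat x n)
  end.

Definition gpow (x : G) (k : Z) : G :=
  match k with
  | Z0 => gone G
  | Zpos p => gpow_nat x (Pos.to_nat p)
  | Zneg p => ginv G (gpow_nat x (Pos.to_nat p))
  end.

Definition comm (x y : G) : G :=
  gmul G (gmul G (gmul G (ginv G x) (ginv G y)) x) y.
Definition conj (y x : G) : G := gmul G (gmul G (ginv G x) y) x.

Definition comm_list (x : G) (ys : list G) : G :=
  fold_left comm ys x.

Inductive in_gen2 (a b : G) : G -> Prop :=
  | gen_a : in_gen2 a b a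
  | gen_b : in_gen2 a b b
  | gen_one : in_gen2 a b (gone G)
  | gen_inv : forall x, in_gen2 a b x -> in_gen2 a b (ginv G x)
  | gen_mul : forall x y, in_gen2 a b x -> in_gen2 a b y -> in_gen2 a b (gmul G x y).

(* The subgroup <a,b> is nilpotent of class <= c: gamma_{c+1}(<a,b>) = 1,
   i.e. every left-normed commutator of weight c+1 of elements of <a,b> is
   trivial (gamma_{c+1} is generated by such commutators). *)
Definition gen2_nilpotent_class_le (a b : G) (c : nat) : Prop :=
  forall x ys, in_gen2 a b x -> length ys = c -> Forall (in_gen2 a b) ys ->
    comm_list x ys = gone G.

Definition G_rels (alpha beta : Z) (a b : G) : Prop :=
  conj a (comm a b) = gpow a alpha /\ conj b (comm b a) = gpow b beta.

End Ops.

(* Main.v *)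
(* Let c = [A, B], so A^c = A^alpha and B^(c^-1) = B^beta.

   Reduction: divide G(alpha, beta) by the union of its upper central series.
   Since G is generated by A and B, an element whose commutators with A and B
   lie in some Z_i lies in Z_(i+1), so the quotient has trivial centre; it
   suffices that a centreless group satisfying the relations is trivial.

   Torsion: w = [A^(c^i), B] lies in <A, c>, and its inverse in <B, c>, so
   w^c w^-1 lies in abelian subgroups containing A and B respectively, hence
   is central and trivial.  So c commutes with w = c^x A^s, x = alpha^i, and
   A^s = (A^s)^c = A^(s alpha).  For i = 2 (or i = 1 if alpha = -1) s is
   nonzero, so A has finite order n, and B has finite order l; alpha may now
   be replaced by a natural number p.

   Arithmetic: from A^B = A c one gets (A^k)^B = c^k A^(p + ... + p^k).
   Taking k = n gives p^n = 1 mod n.  Letting i be the totient of the order of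
   p modulo a prime q | n, the commutation of c with w gives p = 1 mod q.
   Hence c^n = 1, c^(n/q) commutes with A, and c^(n/q) = 1 would make A^(n/q)
   central.  By symmetry c has order n = l, and if n > 1 then c^(n/q) is a
   nontrivial central element. *)
From Stdlib Require Import ZArith List.
From HB Require Import structures.
From mathcomp Require Import all_boot ssralg ssrnum ssrint cyclic generic_quotient boolp.
From mathcomp Require Import zify ring.
Require Import Defs.
Set Implicit Arguments.
Unset Strict Implicit.
Unset Printing Implicit Defensive.
Import GRing.Theory Num.Theory.
(* ssrint and ssrnum rebind the key [Z]. *)
Delimit Scope Z_scope with Z.

(** * Geometric sums modulo primes *)

Section Arithmetic.
Implicit Types k n p q r y : nat.

Definition geom p k := \sum_(i < k) p ^ i.

Lemma geomM p k m : geom p (k * m) = geom p k * geom (p ^ k) m.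
Proof.
rewrite /geom; elim: m => [|m IHm]; first by rewrite muln0 !big_ord0 muln0.
rewrite mulnS addnC big_split_ord /= IHm big_ord_recr /= mulnDr; congr (_ + _).
rewrite big_distrl /=; apply: eq_bigr => i _.
by rewrite expnD expnM mulnC.
Qed.

(** This is (p - 1)(1 + ... + p^(k-1)) = p^k - 1, arranged so that no truncated subtraction
    occurs. *)
Lemma geom_telescope p k : p * geom p k + 1 = geom p k + p ^ k.
Proof.
rewrite /geom; elim: k => [|k IHk]; first by rewrite !big_ord0 muln0.
by rewrite big_ord_recr /= expnS mulnDr addnAC IHk.
Qed.

Lemma geom_mod1 q y k : y = 1 %[mod q] -> geom y k = k %[mod q].
Proof.
move=> y1; rewrite /geom; elim: k => [|k IHk]; first by rewrite big_ord0.
by rewrite big_ord_recr /= -modnDm IHk -modnXm y1 modnXm exp1n modnDm addn1.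
Qed.

(** Sum the first-order expansion (1 + w)^j = 1 + w j modulo w^2 over j < k. *)
Lemma geom_1add w k : geom w.+1 k = k + w * 'C(k, 2) %[mod w ^ 2].
Proof.
have expE j : w.+1 ^ j = 1 + w * j %[mod w ^ 2].
  elim: j => [|j IHj]; first by rewrite muln0.
  rewrite expnS -modnMmr IHj modnMmr.
  by rewrite (_ : w.+1 * _ = j * w ^ 2 + (1 + w * j.+1)) ?modnMDl //; nia.
rewrite /geom; elim: k => [|k IHk]; first by rewrite big_ord0 muln0.
rewrite big_ord_recr /= -modnDm IHk expE modnDm binS bin1.
by congr (_ %% _); nia.
Qed.

Lemma modn_mulIr q r m n : coprime q r ->
  m * r = n * r %[mod q] -> m = n %[mod q].
Proof.
move=> cqr; wlog le_nm : m n / n <= m.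
  by move=> W; case: (leqP n m) => [/W//|/ltnW/W H /esym/H/esym].
move/eqP; rewrite eqn_mod_dvd ?leq_mul2r ?le_nm ?orbT // -mulnBl Gauss_dvdl //.
by rewrite -eqn_mod_dvd // => /eqP.
Qed.

Lemma mod1_addM q y : 0 < q -> y = 1 %[mod q] -> 0 < y -> exists v, y = (q * v).+1.
Proof.
move=> q0 /eqP; case: y => [//|y]; rewrite eqn_mod_dvd // subn1 /= => /dvdnP[v ->] _.
by exists v; rewrite mulnC.
Qed.

(** If q <> r, cancel r. If q = r, write y = 1 + q v: the sum is q + q v C(q, 2) modulo q^2, and q
    divides C(q, 2) because q is odd, which leaves q. *)
Lemma geom_prime_mod q r y : prime q -> 2 < q -> prime r -> 0 < y ->
  y = 1 %[mod r] -> y = 1 %[mod q] ->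
  exists2 t, geom y r = r * t & t = 1 %[mod q].
Proof.
move=> pq q2 pr y0 yr yq.
have /dvdnP[t tE] : r %| geom y r by rewrite /dvdn (geom_mod1 _ yr) modnn.
exists t; first by rewrite mulnC.
have [eqr|nqr] := eqVneq q r; last first.
  have : t * r = r %[mod q] by rewrite -tE geom_mod1.
  rewrite -{2}[r]mul1n; apply: modn_mulIr.
  by rewrite prime_coprime // dvdn_prime2.
subst r; have [v vE] := mod1_addM (prime_gt0 pq) yq y0.
have q0 := prime_gt0 pq.
have := geom_1add (q * v) q; rewrite -vE tE.
have /dvdnP[u ->] : q %| 'C(q, 2) by apply: prime_dvd_bin.
move=> /(congr1 (modn^~ (q ^ 2))); rewrite !modn_dvdm; try by rewrite expnMn dvdn_mulr.
rewrite (_ : q + _ = v * u * q ^ 2 + q); last by lia.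
rewrite modnMDl (_ : q %% q ^ 2 = (1 * q) %% (q * q)) ?mul1n ?mulnn // -{2}mulnn.
by rewrite -[X in _ = X %% _]mul1n -!muln_modl => /eqP; rewrite eqn_pmul2r // => /eqP.
Qed.

(** Induction on k splits off its least prime factor by [geomM]. The condition on u says that an odd
    prime q with p = 1 mod q divides the sum no more often than it divides k. *)
Lemma geom_dvd p k : 0 < k -> 0 < p ->
  (forall r, prime r -> r %| k -> p = 1 %[mod r]) ->
  exists2 u, geom p k = k * u &
    forall q, prime q -> 2 < q -> p = 1 %[mod q] -> u = 1 %[mod q].
Proof.
move=> + p0; elim/ltn_ind: k => k IHk k0 Hk.
have [k1|k1] := leqP k 1.
  have -> : k = 1 by lia.
  by exists 1 => //; rewrite /geom big_ord1.
have pr := pdiv_prime k1; set r := pdiv k in pr.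
have /dvdnP[k' kE] : r %| k := pdiv_dvd k.
have r2 := prime_gt1 pr.
have k'0 : 0 < k' by lia.
have k'k : k' < k by nia.
have [|u uE uq] := IHk k' k'k k'0.
  by move=> s ps sk'; apply: Hk => //; rewrite kE dvdn_mulr.
have pk1 q : p = 1 %[mod q] -> p ^ k' = 1 %[mod q].
  by move=> pq; rewrite -modnXm pq modnXm exp1n.
have pr1 : p ^ k' = 1 %[mod r] by apply/pk1/Hk => //; exact: pdiv_dvd.
have pk0 : 0 < p ^ k' by rewrite expn_gt0 p0.
have /dvdnP[t tE] : r %| geom (p ^ k') r by rewrite /dvdn (geom_mod1 _ pr1) modnn.
exists (u * t); first by rewrite kE geomM uE tE; nia.
move=> q pq q2 pq1.
have [t' t'E t'q] := geom_prime_mod pq q2 pr pk0 pr1 (pk1 _ pq1).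
have -> : t = t' by move: t'E; rewrite tE mulnC => /eqP; rewrite eqn_pmul2l ?prime_gt0 // => /eqP.
by rewrite -modnMm uq // t'q modnMm.
Qed.

End Arithmetic.

Local Open Scope group_scope.

(** * Integer powers and power conjugation *)

Section IntegerPowers.
Variable G : groupType.
Implicit Types (x y : G) (k m : int).

Definition zpow x k : G := match k with Posz n => x ^+ n | Negz n => x ^- n.+1 end.

Lemma zpowN x k : zpow x (- k)%R = (zpow x k)^-1.
Proof. by case: k => [[|n]|n] /=; rewrite ?invg1 ?invgK. Qed.

Lemma zpowS x k : zpow x (k + 1)%R = zpow x k * x.
Proof.
case: k => [n|[|n]]; first by rewrite (_ : (Posz n + 1)%R = Posz n.+1) /= ?expgSr //; lia.
  by rewrite (_ : (Negz 0 + 1)%R = Posz 0) /= ?mulVg //; lia.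
rewrite (_ : (Negz n.+1 + 1)%R = Negz n); last by lia.
by rewrite /= [x ^+ n.+2]expgS invgM mulgVK.
Qed.

Lemma zpowB1 x k : zpow x (k - 1)%R = zpow x k * x^-1.
Proof. by apply: (mulIg x); rewrite -zpowS mulgVK subrK. Qed.

Lemma zpowD x k m : zpow x (k + m)%R = zpow x k * zpow x m.
Proof.
elim/int_ind: m => [|n IH|n IH]; first by rewrite addr0 mulg1.
- by rewrite -[n.+1]addn1 PoszD addrA zpowS IH zpowS mulgA.
- by rewrite -[n.+1]addn1 PoszD opprD addrA zpowB1 IH zpowB1 mulgA.
Qed.

Lemma zpow_nat x k (n : nat) : zpow x (k * Posz n)%R = zpow x k ^+ n.
Proof.
elim: n => [|n IH]; first by rewrite mulr0.
by rewrite -[in LHS]addn1 PoszD mulrDr mulr1 zpowD IH expgSr.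
Qed.

Lemma zpowM x k m : zpow x (k * m)%R = zpow (zpow x k) m.
Proof.
case: m => n; first exact: zpow_nat.
by rewrite NegzE mulrN !zpowN zpow_nat.
Qed.

Lemma zpowJ x y k : zpow x k ^ y = zpow (x ^ y) k.
Proof. by case: k => n /=; rewrite ?conjVg conjXg. Qed.

Lemma commute_zpow x k m : commute (zpow x k) (zpow x m).
Proof. by rewrite /commute -!zpowD addrC. Qed.

Lemma commute_conj x y : commute x y <-> y ^ x = y.
Proof.
rewrite conjgE; split=> [xy|H]; first by rewrite -xy mulKg.
by rewrite /commute -{1}H mulVKg.
Qed.

Lemma commuteJ x y z : commute (x ^ z) (y ^ z) <-> commute x y.
Proof. by rewrite /commute -!conjMg; split=> [/conjg_inj|->]. Qed.

End IntegerPowers.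

(** * The subgroup generated by a and c when c conjugates a to a power *)

Section PowerConjugation.
Variables (G : groupType) (a c : G) (alpha : int).
Hypothesis aJc : a ^ c = zpow a alpha.
Implicit Types u v w : G.

Lemma powerJ k n : zpow a k ^ (c ^+ n) = zpow a (k * alpha ^+ n)%R.
Proof.
elim: n k => [|n IH] k; first by rewrite expg0 conjg1 expr0 mulr1.
by rewrite expgSr conjgM IH zpowJ aJc -zpowM mulrCA -exprS mulrC.
Qed.

Lemma powerJ1 n : a ^ (c ^+ n) = zpow a (alpha ^+ n)%R.
Proof. by have := powerJ 1 n; rewrite mul1r. Qed.

(* The union of the increasing chain of the cyclic groups [c^n <a> c^-n]. *)
Definition roots u := exists n k, u ^ (c ^+ n) = zpow a k.

Lemma roots_self : roots a.
Proof. by exists 0, 1%R; rewrite expg0 conjg1. Qed.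

Lemma roots_widen u n k m : u ^ (c ^+ n) = zpow a k ->
  u ^ (c ^+ (n + m)) = zpow a (k * alpha ^+ m)%R.
Proof. by move=> uE; rewrite expgnDr conjgM uE powerJ. Qed.

Lemma roots_pair u v : roots u -> roots v ->
  exists n k l, u ^ (c ^+ n) = zpow a k /\ v ^ (c ^+ n) = zpow a l.
Proof.
move=> [n [k uE]] [m [l vE]]; exists (n + m)%N, (k * alpha ^+ m)%R, (l * alpha ^+ n)%R.
by split; [apply: roots_widen uE | rewrite addnC; apply: roots_widen vE].
Qed.

Lemma roots_commute u v : roots u -> roots v -> commute u v.
Proof.
move=> ru rv; have [n [k [l [uE vE]]]] := roots_pair ru rv.
by apply/(commuteJ _ _ (c ^+ n)); rewrite uE vE; apply: commute_zpow.
Qed.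

Lemma rootsM u v : roots u -> roots v -> roots (u * v).
Proof.
move=> ru rv; have [n [k [l [uE vE]]]] := roots_pair ru rv.
by exists n, (k + l)%R; rewrite conjMg uE vE zpowD.
Qed.

Lemma rootsV u : roots u -> roots u^-1.
Proof. by move=> [n [k uE]]; exists n, (- k)%R; rewrite conjVg uE zpowN. Qed.

Lemma rootsJ u k : roots u -> roots (u ^ zpow c k).
Proof.
have S v : roots v -> roots (v ^ c).
  move=> [n [l vE]]; exists n, (l * alpha)%R.
  by rewrite -conjgM -expgS expgSr conjgM vE zpowJ aJc -zpowM mulrC.
have P v : roots v -> roots (v ^ c^-1).
  move=> [n [l vE]]; exists n.+1, l.
  by rewrite -conjgM expgS mulKg.
elim/int_ind: k u => [|n IH|n IH] u ru; first by rewrite conjg1.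
  by rewrite -[n.+1]addn1 PoszD zpowS conjgM; apply/S/IH.
by rewrite -[n.+1]addn1 PoszD opprD zpowB1 conjgM; apply/P/IH.
Qed.

(** This is the subgroup <a, c>: the abelian group [roots] is normalised by c, so every element has
    such a form. *)
Definition roots_cyclic w := exists u k, roots u /\ w = u * zpow c k.

Lemma roots_cyclic_a : roots_cyclic a.
Proof. by exists a, 0%R; split; [apply: roots_self | rewrite mulg1]. Qed.

Lemma roots_cyclic_c : roots_cyclic c.
Proof. by exists 1, 1%R; split; [exists 0, 0%R; rewrite conj1g | rewrite mul1g]. Qed.

Lemma roots_cyclicM v w : roots_cyclic v -> roots_cyclic w -> roots_cyclic (v * w).
Proof.
move=> [u [k [ru ->]]] [u' [l [ru' ->]]].
exists (u * u' ^ zpow c (- k)%R), (k + l)%R; split; first by apply/rootsM/rootsJ.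
by rewrite zpowD zpowN conjgE invgK !mulgA mulgVK.
Qed.

Lemma roots_cyclicV w : roots_cyclic w -> roots_cyclic w^-1.
Proof.
move=> [u [k [ru ->]]]; exists (u^-1 ^ zpow c k), (- k)%R.
by split; [apply/rootsJ/rootsV | rewrite zpowN conjgE invgM mulgA mulgK].
Qed.

Lemma roots_cyclicX w k : roots_cyclic w -> roots_cyclic (zpow w k).
Proof.
have N n v : roots_cyclic v -> roots_cyclic (v ^+ n).
  move=> rv; elim: n => [|n IH]; last by rewrite expgS; apply: roots_cyclicM.
  by rewrite expg0 -(mulVg v); apply: roots_cyclicM => //; apply: roots_cyclicV.
by case: k => n rw /=; [|apply: roots_cyclicV]; apply: N.
Qed.

Lemma roots_cyclicJ w k : roots_cyclic w -> roots_cyclic (w ^ zpow c k).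
Proof.
move=> rw; rewrite conjgE; apply: roots_cyclicM.
  by apply/roots_cyclicV/roots_cyclicX/roots_cyclic_c.
by apply: roots_cyclicM => //; apply/roots_cyclicX/roots_cyclic_c.
Qed.

(** The powers of c cancel, which leaves a product of two elements of [roots]. *)
Lemma roots_cyclic_comm w k : roots_cyclic w -> roots (w ^ zpow c k * w^-1).
Proof.
move=> [u [l [ru ->]]].
rewrite conjMg (_ : zpow c l ^ zpow c k = zpow c l); last first.
  by apply/commute_conj/commute_zpow.
by rewrite invgM mulgA mulgK; apply: rootsM; [apply: rootsJ | apply: rootsV].
Qed.

(* [alpha + ... + alpha^n] *)
Fixpoint power_sum (n : nat) : int :=
  if n is n'.+1 then (alpha * (power_sum n' + 1))%R else 0%R.

(** Each a that moves right past a c is raised to the power alpha. *)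
Lemma mul_exp n : (a * c) ^+ n = c ^+ n * zpow a (power_sum n).
Proof.
elim: n => [|n IH]; first by rewrite mulg1.
rewrite !expgSr IH -!mulgA; congr (_ * _).
by rewrite mulgA -zpowS conjgC zpowJ aJc -zpowM.
Qed.

End PowerConjugation.

(** * Groups with the two relations and trivial centre *)

Definition macdonald_rel (G : groupType) (a b : G) (alpha beta : int) :=
  a ^ [~ a, b] = zpow a alpha /\ b ^ [~ b, a] = zpow b beta.

(** Triviality of the centraliser of a and b; this is the centre when a and b generate G. *)
Definition centreless (G : groupType) (a b : G) :=
  forall g, commute g a -> commute g b -> g = 1.

Lemma macdonald_relC (G : groupType) (a b : G) alpha beta :
  macdonald_rel a b alpha beta -> macdonald_rel b a beta alpha.
Proof. by case. Qed.

Lemma centrelessC (G : groupType) (a b : G) : centreless a b -> centreless b a.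
Proof. by move=> H g gb ga; apply: H. Qed.

(** The left side is smaller in absolute value, by induction from n = 2; at n = 1 the two sides
    agree. The difference is the exponent of a in [comm_expE]. *)
Lemma power_sum_neq (alpha : int) n : (2 <= `|alpha|)%N -> (1 < n)%N ->
  power_sum alpha n != (Posz n * alpha ^+ n)%R.
Proof.
move=> al2 n1; suff : (`|power_sum alpha n|.+1 <= n * `|alpha| ^ n)%N.
  by apply: contraTneq => ->; rewrite abszM abszX absz_nat ltnn.
case: n n1 => [//|[//|n]] _; elim: n => [|n IH].
  have -> : (power_sum alpha 2 = alpha * (alpha + 1))%R by rewrite /=; ring.
  by rewrite abszM; nia.
have -> : (power_sum alpha n.+3 = alpha * (power_sum alpha n.+2 + 1))%R by [].
rewrite abszM expnS.
have : (`|(power_sum alpha n.+2 + 1)%R| <= n.+2 * `|alpha| ^ n.+2)%N.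
  by apply: leq_trans IH; lia.
have : (0 < `|alpha| ^ n.+2)%N by rewrite expn_gt0; lia.
move: (`|alpha| ^ n.+2)%N => y y0 H.
by have := leq_mul (leqnn `|alpha|) H; have : (0 < `|alpha| * y)%N; nia.
Qed.


(** * Finite order of the generators *)

Section Torsion.
Variables (G : groupType) (a b : G) (alpha beta : int).
Hypothesis rel_ab : macdonald_rel a b alpha beta.
Hypothesis Z1 : centreless a b.
Let c := [~ a, b].

Let aJc : a ^ c = zpow a alpha. Proof. by case: rel_ab. Qed.
Let bJcV : b ^ c^-1 = zpow b beta. Proof. by rewrite invgR; case: rel_ab. Qed.
Let aJb : a ^ b = a * c. Proof. by rewrite /c commgEl mulVKg. Qed.
Let bJa : b ^ a = b * c^-1. Proof. by rewrite invgR commgEl mulVKg. Qed.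

Lemma expJ_b n : (a ^+ n) ^ b = c ^+ n * zpow a (power_sum alpha n).
Proof. by rewrite conjXg aJb (mul_exp aJc). Qed.

(* The commutator [w] lies in [<a, c>] and its inverse in [<b, c>], so
   [w ^ c * w^-1] lies in two abelian subgroups, one containing [a] and the
   other [b]. *)
Lemma comm_powJ_commute i : commute c [~ a ^ (c ^+ i), b].
Proof.
set w := [~ _, _]; have cE : c = zpow c 1 by rewrite /= expg1.
have wa : roots_cyclic a c w.
  rewrite /w commgEl; apply: (roots_cyclicM aJc).
    apply: (roots_cyclicV aJc); rewrite -[c ^+ i]/(zpow c i).
    by apply/(roots_cyclicJ aJc)/roots_cyclic_a.
  rewrite (powerJ1 aJc) zpowJ aJb.
  apply/(roots_cyclicX aJc)/(roots_cyclicM aJc); first exact: roots_cyclic_a.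
  exact: roots_cyclic_c.
have wb : roots_cyclic b c^-1 w.
  rewrite -[w]invgK; apply: (roots_cyclicV bJcV).
  rewrite [w^-1]invgR commgEl; apply: (roots_cyclicM bJcV).
    by apply/(roots_cyclicV bJcV)/roots_cyclic_a.
  (* Conjugate b by c^-i, a and c^i in turn: the first gives a power of b, the second a power of b
     c^-1, and the third stays inside <b, c>. *)
  have -> : a ^ (c ^+ i) = zpow c^-1 i * (a * zpow c^-1 (- Posz i)%R).
    by rewrite zpowN /zpow expVgn invgK.
  rewrite 2!conjgM.
  apply: (roots_cyclicJ bJcV).
  rewrite -[zpow c^-1 i]/(c^-1 ^+ i) (powerJ1 bJcV) zpowJ bJa.
  apply/(roots_cyclicX bJcV)/(roots_cyclicM bJcV); first exact: roots_cyclic_a.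
  exact: roots_cyclic_c.
have ra := roots_cyclic_comm aJc 1 wa; rewrite -cE in ra.
have rb := roots_cyclic_comm bJcV (-1)%R wb.
rewrite zpowN /= expg1 invgK in rb.
apply/commute_conj/eqP; rewrite -divg_eq1; apply/eqP/Z1.
  exact: (roots_commute aJc ra (roots_self a c)).
exact: (roots_commute bJcV rb (roots_self b c^-1)).
Qed.

(** Moving a^-n right past c^n multiplies its exponent by alpha^n. *)
Lemma comm_expE n :
  [~ a ^+ n, b] = c ^+ n * zpow a (power_sum alpha n - Posz n * alpha ^+ n)%R.
Proof.
rewrite commgEl expJ_b addrC zpowD zpowN -(powerJ aJc (Posz n)) -conjVg.
by rewrite 2!mulgA (conjgC (a ^- n)).
Qed.

Lemma commute_zpow_torsion s : s != 0%R -> alpha != 1%R ->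
  commute c (zpow a s) -> exists2 n, (0 < n)%N & a ^+ n = 1.
Proof.
move=> s0 alpha1 /commute_conj; rewrite zpowJ aJc -zpowM => H.
have : zpow a (alpha * s - s)%R = 1 by rewrite zpowD zpowN H mulgV.
have : (alpha * s - s != 0)%R by rewrite -{2}[s]mul1r -mulrBl mulf_neq0 // subr_eq0.
case: (alpha * s - s)%R => [n|n] n0 /= an1; [exists n | exists n.+1] => //.
  by rewrite lt0n.
by apply: invg_inj; rewrite an1 invg1.
Qed.

Lemma commute_zpowM k g : commute c (zpow c k * g) -> commute c g.
Proof.
move=> /commute_conj; rewrite conjMg zpowJ (_ : c ^ c = c); last exact/commute_conj.
by move=> /mulgI H; apply/commute_conj.
Qed.

Lemma a_torsion : alpha != 1%R -> exists2 n, (0 < n)%N & a ^+ n = 1.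
Proof.
move=> alpha1.
have [alpha0|alpha0] := eqVneq alpha 0%R.
  exists 1%N => //; apply/eqP; rewrite expg1 -(conjg_eq1 _ c).
  by rewrite aJc alpha0.
have [alphaN1|alphaN1] := eqVneq alpha (-1)%R.
  (* Here i = 2 would give w = c and no information, while i = 1 gives w = c^-1 a^-2. *)
  have := comm_powJ_commute 1%N; rewrite (powerJ1 aJc) expr1 alphaN1.
  rewrite [zpow a _]/(a^-1) commgEl conjVg invgK aJb invgM mulgA.
  have -> : a * c^-1 * a^-1 = zpow c (-1)%R * zpow a (-2)%R.
    have ac : a * c = c * a^-1 by rewrite conjgC aJc alphaN1.
    have ca : c * a = a^-1 * c by apply: (mulgI a); rewrite mulVKg mulgA ac mulgVK.
    have caV : a * c^-1 = c^-1 * a^-1.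
      by apply: (mulgI c); apply: (mulIg c); rewrite mulVKg (mulgA c a) mulgVK ca.
    by rewrite caV /= expg1 expg2 (invgM a a) mulgA.
  by move/commute_zpowM; apply: commute_zpow_torsion.
have al2 : (2 <= `|alpha|)%N by move: alpha1 alpha0 alphaN1; lia.
(* The choice i = 2 makes alpha^i a natural number whatever the sign of alpha, so [comm_expE]
   applies. *)
set n := (`|alpha| ^ 2)%N.
have nE : (alpha ^+ 2 = Posz n)%R by rewrite /n -abszX abszE ger0_norm ?sqr_ge0.
have := comm_powJ_commute 2%N; rewrite (powerJ1 aJc) nE [zpow a _]/(a ^+ n) comm_expE.
rewrite -[c ^+ n]/(zpow c (Posz n)) => /commute_zpowM.
apply: commute_zpow_torsion => //.
by rewrite subr_eq0 power_sum_neq // /n; nia.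
Qed.

End Torsion.

Lemma power_sum_geom (p k : nat) : power_sum p k = Posz (p * geom p k)%N.
Proof.
have S m : (geom p m.+1 = p * geom p m + 1)%N by rewrite geom_telescope /geom big_ord_recr.
elim: k => [|k IH]; first by rewrite /geom big_ord0 muln0.
by rewrite /= IH S; lia.
Qed.

Lemma modn_order p q : (1 < q)%N -> (exists2 k, 0 < k & p ^ k = 1 %[mod q])%N ->
  exists d, [/\ (0 < d)%N, (p ^ d = 1 %[mod q])%N &
    forall k, (p ^ k = 1 %[mod q])%N -> (d %| k)%N].
Proof.
move=> q1 ex.
have exb : exists k, (0 < k)%N && (p ^ k == 1 %[mod q])%N.
  by case: ex => k k0 /eqP pk; exists k; rewrite k0.
case: (ex_minnP exb) => d /andP[d0 /eqP pd] dmin; exists d; split=> // k pk.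
apply/eqP; case: (posnP (k %% d)%N) => // m0.
have : (d <= k %% d)%N.
  apply: dmin; rewrite m0 /=; apply/eqP.
  rewrite -pk [in RHS](divn_eq k d) expnD [(_ * d)%N]mulnC expnM.
  by rewrite -[in RHS]modnMml -[in RHS]modnXm pd modnXm exp1n modnMml mul1n.
by rewrite leqNgt ltn_mod d0.
Qed.

Lemma order_exists (G : groupType) (x : G) : (exists2 n, (0 < n)%N & x ^+ n = 1) ->
  exists2 n, (0 < n)%N & forall k, (x ^+ k == 1) = (n %| k)%N.
Proof.
move=> [m m0 xm].
have exb : exists k, (0 < k)%N && (x ^+ k == 1) by exists m; rewrite m0 xm eqxx.
case: (ex_minnP exb) => n /andP[n0 /eqP xn] nmin; exists n => // k.
apply/eqP/dvdnP => [xk|[j ->]]; last by rewrite mulnC expgnA xn expg1n.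
exists (k %/ n)%N; rewrite {1}(divn_eq k n).
case: (posnP (k %% n)%N) => [->|r0]; first by rewrite addn0.
have : (n <= k %% n)%N.
  apply: nmin; rewrite r0 /= -xk [in X in _ == X](divn_eq k n) expgnDr.
  by rewrite [(_ * n)%N]mulnC expgnA xn expg1n mul1g.
by rewrite leqNgt ltn_mod n0.
Qed.

Lemma ltn_totient d : (1 < d)%N -> (totient d < d)%N.
Proof.
move=> d1; rewrite totient_count_coprime big_ltn ?(ltnW d1) //.
rewrite /coprime gcdn0 gtn_eqF // add0n.
apply: (@leq_ltn_trans (\sum_(1 <= i < d) 1)%N); last by rewrite sum_nat_const_nat; lia.
by apply: leq_sum => i _; case: (_ == _).
Qed.

(** The congruence reads (x - 1)(y - 1) = 0 modulo q. *)
Lemma mod1_or q x y : prime q -> (0 < x)%N -> (0 < y)%N ->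
  (x + y = x * y + 1 %[mod q])%N -> (x = 1 %[mod q])%N \/ (y = 1 %[mod q])%N.
Proof.
case: x => // x; case: y => // y pq _ _ /esym/eqP.
rewrite (_ : x.+1 * y.+1 + 1 = x * y + (x.+1 + y.+1))%N; last by lia.
rewrite -[X in _ == X %[mod _]]add0n eqn_modDr mod0n -/(q %| _) Euclid_dvdM //.
by case/orP => /dvdnP[v ->]; [left|right]; rewrite -addn1 modnMDl.
Qed.

(** * The orders of a and of c *)

Section Orders.
Variables (G : groupType) (a b : G) (p n : nat) (beta : int).
Hypothesis rel_ab : macdonald_rel a b p beta.
Hypothesis Z1 : centreless a b.
Hypothesis n_gt0 : (0 < n)%N.
Hypothesis a_order : forall k, (a ^+ k == 1) = (n %| k)%N.
Let c := [~ a, b].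

Let aJc : a ^ c = zpow a p. Proof. by case: rel_ab. Qed.

Lemma a_expE k l : a ^+ k = a ^+ l <-> (k = l %[mod n])%N.
Proof.
wlog le_lk : k l / (l <= k)%N.
  by move=> W; case: (leqP l k) => [/W//|/ltnW/W H]; split=> /esym/H.
have E : (k == l %[mod n])%N = (a ^+ k == a ^+ l).
  by rewrite eqn_mod_dvd // -a_order expgnFr // divg_eq1.
by split=> /eqP H; apply/eqP; rewrite ?E // -E.
Qed.

Lemma a_exp_order : a ^+ n = 1.
Proof. by apply/eqP; rewrite a_order. Qed.

Lemma expJ_c k i : (a ^+ k) ^ (c ^+ i) = a ^+ (k * p ^ i).
Proof. by rewrite -[a ^+ k]/(zpow a k) (powerJ aJc) -rmorphXn. Qed.

Lemma expJ_c1 k : (a ^+ k) ^ c = a ^+ (k * p).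
Proof. by have := expJ_c k 1; rewrite expn1. Qed.

Lemma expJ_b_geom k : (a ^+ k) ^ b = c ^+ k * a ^+ (p * geom p k).
Proof. by rewrite (expJ_b rel_ab) power_sum_geom. Qed.

Lemma c_order_mod : c ^+ n = a ^- (p * geom p n).
Proof.
by apply/eqP; rewrite -mulg_eq1 -expJ_b_geom a_exp_order conj1g.
Qed.

(** By [c_order_mod], c^n is a power of a and so fixes a, while conjugation by c^n raises a to the
    power p^n. *)
Lemma expn_order_mod : (p ^ n = 1 %[mod n])%N.
Proof.
apply/a_expE; rewrite -[(p ^ n)%N]mul1n -expJ_c !expg1.
apply/commute_conj/commute_sym; rewrite c_order_mod.
by apply/commuteV/commuteX/commute_refl.
Qed.

Lemma coprime_order : coprime p n.
Proof.
have [->|n1] := eqVneq n 1%N; first exact: coprimen1.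
have : coprime (p ^ n) n.
  by rewrite -coprime_modl expn_order_mod coprime_modl coprime1n.
by rewrite coprime_pexpl.
Qed.

(* [comm_powJ_commute] read off on the exponents of [a], with terms moved so
   that no subtraction occurs. *)
Lemma order_congruence i (x := (p ^ i)%N) :
  (p * (p * geom p x) + x * p ^ x = p * geom p x + p * (x * p ^ x) %[mod n])%N.
Proof.
have := comm_powJ_commute rel_ab Z1 i.
rewrite -/c -[a]expg1 expJ_c mul1n -/x (comm_expE rel_ab).
rewrite -[c ^+ x]/(zpow c x) => /commute_zpowM.
rewrite power_sum_geom -rmorphXn -rmorphM /= zpowD zpowN /= => /commute_conj.
rewrite conjMg conjVg !expJ_c1 => H.
apply/a_expE; rewrite !expgnDr.
apply: (mulIg (a ^- (x * p ^ x * p))); rewrite (mulnC p (x * _)%N) mulgK.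
rewrite [(p * (p * _))%N]mulnC -mulgA.
have aC k l : commute (a ^+ k) (a ^- l) by apply/commuteV/commuteX2/commute_refl.
by rewrite aC mulgA H mulgVK.
Qed.

Lemma prime_order_mod1 q : prime q -> (q %| n)%N -> (p = 1 %[mod q])%N.
Proof.
move=> pq qn; have q1 := prime_gt1 pq.
have modq k l : (k = l %[mod n] -> k = l %[mod q])%N.
  by move=> /(congr1 (modn^~ q)); rewrite !modn_dvdm.
have copq : coprime p q by rewrite (coprime_dvdr qn) ?coprime_order.
have [|d [d0 pd dP]] := @modn_order p q q1.
  by exists n => //; apply/modq/expn_order_mod.
have dn : (d %| n)%N by apply/dP/modq/expn_order_mod.
have [d1|d1] := leqP d 1; first by move: pd; rewrite (_ : d = 1%N) ?expn1 //; lia.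
(* Suppose the order d of p modulo q exceeds 1. By Euler x = 1 mod d, hence p^x = p mod q, which
   removes the double exponential from [order_congruence]. *)
set i := totient d; set x := (p ^ i)%N.
have p0 : (0 < p)%N.
  by case: (posnP p) copq => // ->; rewrite /coprime gcd0n => /eqP; lia.
have xd : (x = 1 %[mod d])%N by apply: Euler_exp_totient; rewrite (coprime_dvdr dn) ?coprime_order.
have pxq : (p ^ x = p %[mod q])%N.
  have x0 : (0 < x)%N by rewrite expn_gt0 p0.
  have [v ->] := mod1_addM d0 xd x0.
  by rewrite expnS expnM -modnMmr -modnXm pd modnXm exp1n modnMmr muln1.
have xq : (x = 1 %[mod q])%N.
  have := order_congruence i; rewrite -/x => /modq.
  have := geom_telescope p x; move: (geom p x) => g gE /eqP.
  (* Adding p to both sides lets the telescoping identity eliminate the geometric sum; after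
     cancelling p there remains p + x = p x + 1 modulo q. *)
  rewrite -(eqn_modDr p).
  have {}gE : (p * (p * g) + p = p * g + p * p ^ x)%N by rewrite -mulnDr -gE mulnDr muln1.
  rewrite addnAC gE -addnA -mulnDl -addnA eqn_modDl -modnMmr pxq modnMmr.
  rewrite mulnA -(modnDml (p * x * p ^ x)) -(modnMmr (p * x)) pxq modnMmr modnDml.
  rewrite (_ : p * x * p + p = (p * x + 1) * p)%N; last by rewrite mulnDl mul1n.
  move=> /eqP/modn_mulIr; rewrite coprime_sym => /(_ copq)/(mod1_or pq p0).
  rewrite expn_gt0 p0 => /(_ isT)[p1|//].
  by have := d1; rewrite ltnNge dvdn_leq // dP.
(* Now p^i = 1 mod q makes d divide its own totient, which lies strictly between 0 and d. *)
have := dP _ xq; rewrite gtnNdvd //; first by rewrite totient_gt0.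
exact: ltn_totient.
Qed.

Lemma order_dvd_mod1 k : (k %| n)%N -> forall r, prime r -> (r %| k)%N -> (p = 1 %[mod r])%N.
Proof. by move=> kn r pr rk; apply: prime_order_mod1 => //; apply: dvdn_trans kn. Qed.

Lemma c_exp_order : c ^+ n = 1.
Proof.
have [p0|p0] := posnP p; last first.
  have [u gE _] := geom_dvd n_gt0 p0 (order_dvd_mod1 (dvdnn n)).
  by apply/eqP; rewrite c_order_mod invg_eq1 a_order gE mulnCA dvdn_mulr.
by rewrite c_order_mod p0 mul0n invg1.
Qed.

Lemma p_gt0 : (1 < n)%N -> (0 < p)%N.
Proof.
by move=> n1; case: (posnP p) coprime_order => // ->; rewrite /coprime gcd0n; lia.
Qed.

(** With k = n / q, if c^k = 1 then b conjugates a^k, of order q, to its power p u. This power is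
    a^k itself, so a^k would be central and nontrivial. *)
Lemma c_exp_neq1 q : prime q -> (q %| n)%N -> c ^+ (n %/ q) <> 1.
Proof.
move=> pq qn; set k := (n %/ q)%N.
have nE : n = (k * q)%N by rewrite divnK.
have k0 : (0 < k)%N by move: n_gt0; rewrite nE muln_gt0 => /andP[].
have q1 := prime_gt1 pq.
have p0 : (0 < p)%N by apply: p_gt0; nia.
have kn : (k %| n)%N by rewrite nE dvdn_mulr.
have pq1 : (p = 1 %[mod q])%N by apply: prime_order_mod1.
have ak : a ^+ k != 1 by rewrite a_order nE -{2}[k]muln1 dvdn_pmul2l // dvdn1; lia.
have [u gE uq] := geom_dvd k0 p0 (order_dvd_mod1 kn).
move=> ck; have := expJ_b_geom k; rewrite ck mul1g gE => akb.
suff akbE : (a ^+ k) ^ b = a ^+ k.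
  case/eqP: ak; apply: Z1; first by apply/commute_sym/commuteX/commute_refl.
  by apply/commute_sym/commute_conj.
have modk l : (l = 1 %[mod q])%N -> a ^+ (k * l) = a ^+ k.
  move=> l1; apply/a_expE; rewrite nE -!muln_modr l1 muln_modr muln1 //.
move: akb; rewrite mulnCA => akb; rewrite akb; apply: modk.
have [q2|q2] := leqP q 2; last by rewrite -modnMm pq1 uq // modnMm.
(* For q = 2 [geom_dvd] says nothing about u, but a^k has order 2 and its conjugate is not 1, so p u
   is odd. *)
have {q2}q2 : q = 2 by lia.
rewrite q2 modn2; case: (boolP (odd (p * u))) => [//|even_pu].
have : (a ^+ k) ^ b = 1.
  rewrite akb; apply/eqP; rewrite a_order nE dvdn_pmul2l // q2 dvdn2 //.
by move/eqP; rewrite conjg_eq1 (negPf ak).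
Qed.

(** With k = n / q, p^k - 1 is (p - 1) times the geometric sum; q divides the first factor and k the
    second, so n divides the product. *)
Lemma commute_a_c_exp q : prime q -> (q %| n)%N -> commute (c ^+ (n %/ q)) a.
Proof.
move=> pq qn; set k := (n %/ q)%N.
have nE : n = (k * q)%N by rewrite divnK.
have k0 : (0 < k)%N by move: n_gt0; rewrite nE muln_gt0 => /andP[].
have q1 := prime_gt1 pq.
have p0 : (0 < p)%N by apply: p_gt0; nia.
have kn : (k %| n)%N by rewrite nE dvdn_mulr.
have [u gE _] := geom_dvd k0 p0 (order_dvd_mod1 kn).
have /eqP := prime_order_mod1 pq qn; rewrite eqn_mod_dvd // => /dvdnP[v vE].
apply/commute_conj; rewrite -[a]expg1 expJ_c mul1n; apply/a_expE/eqP.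
rewrite eqn_mod_dvd ?expn_gt0 ?p0 //.
rewrite (_ : p ^ k - 1 = (p - 1) * geom p k)%N; last by have := geom_telescope p k; nia.
by rewrite vE gE nE; apply/dvdnP; exists (v * u)%N; nia.
Qed.

End Orders.

(** * Triviality of the centreless groups *)

Lemma macdonald_nat_exp (G : groupType) (a b : G) alpha beta n :
  (0 < n)%N -> a ^+ n = 1 -> macdonald_rel a b alpha beta ->
  exists p : nat, macdonald_rel a b p beta.
Proof.
(* Adding |alpha| n keeps the exponent modulo n and makes it nonnegative, as n >= 1. *)
move=> n0 an [ra rb]; exists `|(alpha + Posz (`|alpha| * n))%R|%N; split=> //.
rewrite gez0_abs; last by nia.
by rewrite zpowD PoszM zpow_nat /= -expgnA mulnC expgnA an expg1n mulg1.
Qed.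

Lemma macdonald_order_dvd (G : groupType) (a b : G) (p r n l : nat) :
  macdonald_rel a b p r -> centreless a b -> (0 < n)%N -> (0 < l)%N ->
  (forall k, (a ^+ k == 1) = (n %| k)%N) -> (forall k, (b ^+ k == 1) = (l %| k)%N) ->
  (n %| l)%N.
Proof.
move=> rel Z n0 l0 oa ob.
have cn := c_exp_order rel Z n0 oa.
have cl : [~ a, b] ^+ l = 1.
  have := c_exp_order (macdonald_relC rel) (centrelessC Z) l0 ob.
  by rewrite -invgR expVgn => /eqP; rewrite invg_eq1 => /eqP.
have [m m0 oc] := order_exists (ex_intro2 _ _ n n0 cn).
have mn : (m %| n)%N by rewrite -oc cn.
have ml : (m %| l)%N by rewrite -oc cl.
have [nm1|nm1] := leqP (n %/ m) 1.
  suff <- : m = n by [].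
  have := divnK mn; have : (0 < n %/ m)%N by rewrite divn_gt0 // dvdn_leq.
  by nia.
(* If the order m of c were a proper divisor of n, a prime q dividing n / m would give m | n / q,
   hence c^(n/q) = 1. *)
have pq := pdiv_prime nm1; have qd := pdiv_dvd (n %/ m).
have qn : (pdiv (n %/ m) %| n)%N by apply: dvdn_trans qd (dvdn_div mn).
case: (c_exp_neq1 rel Z n0 oa pq qn); apply/eqP; rewrite oc.
by have := dvdn_mul (dvdnn m) qd; rewrite [X in (_ %| X)%N]mulnC divnK // dvdn_divRL.
Qed.

Lemma macdonald_centreless (G : groupType) (a b : G) (alpha beta : int) :
  alpha != 1%R -> beta != 1%R -> macdonald_rel a b alpha beta -> centreless a b ->
  a = 1 /\ b = 1.
Proof.
move=> alpha1 beta1 rel Z.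
have [n0 n0_gt0 an0] := a_torsion rel Z alpha1.
have [l0 l0_gt0 bl0] := a_torsion (macdonald_relC rel) (centrelessC Z) beta1.
have [p relp] := macdonald_nat_exp n0_gt0 an0 rel.
have [r rel'] := macdonald_nat_exp l0_gt0 bl0 (macdonald_relC relp).
have {rel'}relpr := macdonald_relC rel'.
have [n n_gt0 oa] := order_exists (ex_intro2 _ _ n0 n0_gt0 an0).
have [l l_gt0 ob] := order_exists (ex_intro2 _ _ l0 l0_gt0 bl0).
have nl := macdonald_order_dvd relpr Z n_gt0 l_gt0 oa ob.
have ln := macdonald_order_dvd (macdonald_relC relpr) (centrelessC Z) l_gt0 n_gt0 ob oa.
have {nl ln}lE : l = n by apply/eqP; rewrite eqn_dvd ln.
subst l; have [n1|n1] := leqP n 1.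
  have n1E : n = 1%N by lia.
  by split; apply/eqP; [rewrite -[a]expg1 oa | rewrite -[b]expg1 ob]; rewrite n1E.
have pq := pdiv_prime n1; have qn := pdiv_dvd n.
case: (c_exp_neq1 relpr Z n_gt0 oa pq qn); apply: (Z).
  exact: (commute_a_c_exp relpr Z n_gt0 oa pq qn).
have := commute_a_c_exp (macdonald_relC relpr) (centrelessC Z) n_gt0 ob pq qn.
rewrite -invgR expVgn => /commute_sym/commuteV; rewrite invgK.
exact: commute_sym.
Qed.

(** * The quotient by the hypercentre *)

HB.instance Definition _ (H : Group) := gen_eqMixin (carrier H).
HB.instance Definition _ (H : Group) := gen_choiceMixin (carrier H).
HB.instance Definition _ (H : Group) :=
  isGroup.Build (carrier H) (@gmul_assoc H) (@gmul_1l H) (@gmul_1r H)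
    (@gmul_Vl H) (@gmul_Vr H).

Lemma commE (H : Group) (x y : H) : comm H x y = [~ x, y].
Proof. by rewrite commgEl conjgE !mulgA. Qed.

Lemma conjE (H : Group) (x y : H) : conj H y x = y ^ x.
Proof. by rewrite conjgE mulgA. Qed.

(** The converted exponent is the same for all groups; the implication carries over the hypothesis
    that it is not 1. *)
Lemma gpowE (k : Z) : exists l : int,
  (l = 1%R -> k = 1%Z) /\ forall (H : Group) (x : H), gpow H x k = zpow x l.
Proof.
have natE (H : Group) (x : H) n : gpow_nat H x n = x ^+ n.
  by elim: n => //= n ->; rewrite expgS.
case: k => [|p|p]; first by exists 0%R.
  by exists (Posz (Pos.to_nat p)); split=> [|H x]; [lia | rewrite /= natE].
exists (- Posz (Pos.to_nat p))%R; split=> [|H x]; first by lia.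
by rewrite zpowN /= natE.
Qed.

(** * The upper central series of a two-generator subgroup *)

Section UpperCentral.
Variables (H : Group) (a b : H).
Local Notation gen := (in_gen2 H a b).
Implicit Types g h : H.

(** On <a, b> this is the i-th term of its upper central series; membership of g in <a, b> is left
    to the lemmas that need it. *)
Fixpoint ucs (i : nat) (g : H) : Prop :=
  if i is i'.+1 then forall h, gen h -> ucs i' [~ g, h] else g = 1.

Lemma genM g h : gen g -> gen h -> gen (g * h). Proof. exact: gen_mul. Qed.
Lemma genV g : gen g -> gen g^-1. Proof. exact: gen_inv. Qed.

Lemma genJ g h : gen g -> gen h -> gen (g ^ h).
Proof. by move=> Sg Sh; rewrite conjgE; apply/genM/genM => //; apply: genV. Qed.

Lemma genR g h : gen g -> gen h -> gen [~ g, h].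
Proof. by move=> Sg Sh; rewrite commgEl; apply/genM/genJ => //; apply: genV. Qed.

Lemma ucs1 i : ucs i 1.
Proof. by elim: i => //= i IH h Sh; rewrite comm1g. Qed.

Lemma ucsJ i g h : gen h -> ucs i g -> ucs i (g ^ h).
Proof.
elim: i g => [|i IH] g Sh /= Zg; first by rewrite Zg conj1g.
move=> k Sk; rewrite (_ : [~ g ^ h, k] = [~ g, k ^ h^-1] ^ h); last first.
  by rewrite conjRg conjgKV.
by apply: IH => //; apply: Zg; apply: genJ => //; apply: genV.
Qed.

Lemma ucsM i g h : gen h -> ucs i g -> ucs i h -> ucs i (g * h).
Proof.
elim: i g h => [|i IH] g h Sh /=; first by move=> -> ->; rewrite mulg1.
move=> Zg Zh k Sk.
rewrite (_ : [~ g * h, k] = [~ g, k] ^ h * [~ h, k]); last first.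
  by rewrite !commgEl !conjgE !invgM !mulgA !mulgK.
by apply: IH; [apply: genR | apply/ucsJ/Zg | apply: Zh].
Qed.

Lemma ucsV i g : gen g -> ucs i g -> ucs i g^-1.
Proof.
elim: i g => [|i IH] g Sg /= Zg; first by rewrite Zg invg1.
move=> k Sk; rewrite (_ : [~ g^-1, k] = [~ g, k]^-1 ^ g^-1); last first.
  by rewrite invgR !commgEl !conjgE !invgK !mulgA mulgK.
by apply: ucsJ; [apply: genV | apply: IH; [apply: genR | apply: Zg]].
Qed.

Lemma ucsS i g : ucs i g -> ucs i.+1 g.
Proof.
elim: i g => [|i IH] g /= Zg h Sh; first by rewrite Zg comm1g.
by apply: IH; apply: Zg.
Qed.

Lemma ucs_le i j g : (i <= j)%N -> ucs i g -> ucs j g.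
Proof. by move=> /subnK <- Zg; elim: (j - i)%N => //= m IH; apply: ucsS. Qed.

(** Induction on h, by the commutator identities for inverses and products in the second
    argument. *)
Lemma ucs_gen i g : gen g -> ucs i [~ g, a] -> ucs i [~ g, b] -> ucs i.+1 g.
Proof.
move=> Sg Za Zb h Sh; elim: Sh => //.
- by rewrite (commg1 g : [~ g, gone H] = 1); apply: ucs1.
- move=> x Sx Zx; change (ucs i [~ g, x^-1]).
  rewrite (_ : [~ g, x^-1] = [~ g, x]^-1 ^ x^-1); last first.
    by rewrite invgR !commgEl !conjgE !invgK !mulgA mulgV mul1g.
  by apply: ucsJ; [apply: genV | apply: ucsV => //; apply: genR].
- move=> x y Sx Zx Sy Zy; change (ucs i [~ g, x * y]).
  rewrite (_ : [~ g, x * y] = [~ g, y] * [~ g, x] ^ y); last first.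
    by rewrite !commgEl !conjgE !invgM !mulgA !mulgK.
  by apply: ucsM; [apply/genJ => //; apply: genR | | apply: ucsJ].
Qed.

Lemma ucs_nilpotent c : ucs c a -> ucs c b -> gen2_nilpotent_class_le H a b c.
Proof.
move=> Za Zb.
have Zall g : gen g -> ucs c g.
  elim=> // [|x Sx Zx|x y Sx Zx Sy Zy]; first exact: ucs1.
    exact: ucsV.
  exact: ucsM.
move=> x ys Sx; have {Za Zb Zall} := Zall x Sx.
elim: ys c x {Sx} => [|y ys IH] c x Zx lc /= Sys; subst c; first exact: Zx.
inversion Sys as [|? ? Sy Sys']; subst.
by apply: IH => //; rewrite commE; apply: Zx.
Qed.

End UpperCentral.

(** * Formal words standing for the elements of G(alpha, beta) *)

Inductive word := Wa | Wb | W1 | Wv of word | Wm of word & word.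

HB.instance Definition _ := gen_eqMixin word.
HB.instance Definition _ := gen_choiceMixin word.

Fixpoint weval (G : groupType) (a b : G) (w : word) : G :=
  match w with
  | Wa => a
  | Wb => b
  | W1 => 1
  | Wv w => (weval a b w)^-1
  | Wm u v => weval a b u * weval a b v
  end.

Definition Wz (w : word) (k : int) : word :=
  match k with
  | Posz n => iter n (Wm w) W1
  | Negz n => Wv (iter n.+1 (Wm w) W1)
  end.

Definition Wcomm (u v : word) := Wm (Wv u) (Wm (Wv v) (Wm u v)).
Definition Wconj (u v : word) := Wm (Wv v) (Wm u v).

Lemma weval_z (G : groupType) (a b : G) w k : weval a b (Wz w k) = zpow (weval a b w) k.
Proof.
have N n : weval a b (iter n (Wm w) W1) = weval a b w ^+ n.
  by elim: n => //= n ->; rewrite expgS.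
by case: k => n; [exact: N | exact: (congr1 (@inv G) (N n.+1))].
Qed.

Lemma weval_gen (H : Group) (a b : H) w : in_gen2 H a b (weval a b w).
Proof.
elim: w => [|||w IH|u IHu v IHv]; first exact: gen_a.
- exact: gen_b.
- exact: gen_one.
- exact: gen_inv.
- exact: gen_mul.
Qed.

Section Hypercentral.
Variables alpha beta : Z.

(** As i is chosen before H, this describes the union of the upper central series of G(alpha, beta)
    without constructing that group, and gives one class bound for all H. *)
Definition hypercentral (w : word) := exists i, forall (H : Group) (a b : H),
  G_rels H alpha beta a b -> ucs a b i (weval a b w).

Lemma hypercentral_eq u v :
  (forall (H : Group) (a b : H), G_rels H alpha beta a b -> weval a b u = weval a b v) ->
  hypercentral u -> hypercentral v.
Proof. by move=> uv [i Zu]; exists i => H a b rel; rewrite -uv //; apply: Zu. Qed.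

Lemma hypercentral1 : hypercentral W1.
Proof. by exists 0. Qed.

Lemma hypercentralM u v : hypercentral u -> hypercentral v -> hypercentral (Wm u v).
Proof.
move=> [i Zu] [j Zv]; exists (maxn i j) => H a b rel /=.
apply: ucsM; first exact: weval_gen.
  by apply: ucs_le (Zu _ _ _ rel); apply: leq_maxl.
by apply: ucs_le (Zv _ _ _ rel); apply: leq_maxr.
Qed.

Lemma hypercentralV u : hypercentral u -> hypercentral (Wv u).
Proof.
by move=> [i Zu]; exists i => H a b rel /=; apply: ucsV; [apply: weval_gen | apply: Zu].
Qed.

Lemma hypercentralJ u v : hypercentral u -> hypercentral (Wconj u v).
Proof.
move=> [i Zu]; exists i => H a b rel.
by apply: (@ucsJ H a b i _ (weval a b v)); [apply: weval_gen | apply: Zu].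
Qed.

(** Two generators involve only two levels, so one level above their maximum suffices; this is why
    the quotient by the union of the series has trivial centre. *)
Lemma hypercentral_gen u :
  hypercentral (Wcomm u Wa) -> hypercentral (Wcomm u Wb) -> hypercentral u.
Proof.
move=> [i Za] [j Zb]; exists (maxn i j).+1 => H a b rel.
apply: ucs_gen; first exact: weval_gen.
  by apply: ucs_le (Za _ _ _ rel); apply: leq_maxl.
by apply: ucs_le (Zb _ _ _ rel); apply: leq_maxr.
Qed.

Definition hyper_equiv : rel word := fun u v => `[< hypercentral (Wm (Wv u) v) >].

Lemma hyper_equiv_refl : reflexive hyper_equiv.
Proof.
move=> u; apply/asboolP; apply: hypercentral_eq hypercentral1 => H a b _ /=.
by rewrite mulVg.
Qed.

Lemma hyper_equiv_sym : symmetric hyper_equiv.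
Proof.
have S u v : hyper_equiv u v -> hyper_equiv v u.
  move=> /asboolP/hypercentralV Z; apply/asboolP; apply: hypercentral_eq Z => H a b _ /=.
  by rewrite invgM invgK.
by move=> u v; apply/idP/idP; apply: S.
Qed.

Lemma hyper_equiv_trans : transitive hyper_equiv.
Proof.
move=> v u w /asboolP Zuv /asboolP Zvw; apply/asboolP.
apply: hypercentral_eq (hypercentralM Zuv Zvw) => H a b _ /=.
by rewrite mulgA mulgK.
Qed.

Canonical hyper_equivRel :=
  EquivRel hyper_equiv hyper_equiv_refl hyper_equiv_sym hyper_equiv_trans.

Definition centreless_quotient := {eq_quot hyper_equiv}%qT.
Local Notation Q := centreless_quotient.
Local Notation class := (\pi_({eq_quot hyper_equiv})%qT : word -> Q).

HB.instance Definition _ := Choice.on Q.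

Lemma classP u v : class u = class v <-> hypercentral (Wm (Wv u) v).
Proof. by split=> [/eqmodP/asboolP|Z] //; apply/eqmodP/asboolP. Qed.

Lemma class_eval u v :
  (forall (H : Group) (a b : H), G_rels H alpha beta a b -> weval a b u = weval a b v) ->
  class u = class v.
Proof.
move=> uv; apply/classP; apply: hypercentral_eq hypercentral1 => H a b rel /=.
by rewrite uv // mulVg.
Qed.

Definition qmul (x y : Q) : Q := class (Wm (repr x) (repr y)).
Definition qinv (x : Q) : Q := class (Wv (repr x)).

(** Well-definedness rests on normality of the hypercentre: the discrepancy of the first factor is
    conjugated past the second. *)
Lemma qmulE u v : qmul (class u) (class v) = class (Wm u v).
Proof.
have /classP Zu : class (repr (class u)) = class u by exact: reprK.
have /classP Zv : class (repr (class v)) = class v by exact: reprK.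
apply/classP; apply: hypercentral_eq (hypercentralM (hypercentralJ (repr (class v)) Zu) Zv).
by move=> H a b _ /=; rewrite !invgM !mulgA mulgK.
Qed.

Lemma qinvE u : qinv (class u) = class (Wv u).
Proof.
have /classP Zu : class (repr (class u)) = class u by exact: reprK.
apply/classP; apply: hypercentral_eq (hypercentralJ (Wv (repr (class u))) (hypercentralV Zu)).
by move=> H a b _ /=; rewrite !invgM !invgK !mulgA mulgK.
Qed.

Lemma class_surj x : exists u, x = class u.
Proof. by exists (repr x); rewrite reprK. Qed.

Fact qmulA : associative qmul.
Proof.
move=> x y z; have [u ->] := class_surj x; have [v ->] := class_surj y.
have [w ->] := class_surj z; rewrite !qmulE; apply: class_eval => H a b _ /=.
exact: mulgA.
Qed.

Fact qmul1g : left_id (class W1) qmul.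
Proof.
move=> x; have [u ->] := class_surj x; rewrite qmulE; apply: class_eval => H a b _ /=.
exact: mul1g.
Qed.

Fact qmulg1 : right_id (class W1) qmul.
Proof.
move=> x; have [u ->] := class_surj x; rewrite qmulE; apply: class_eval => H a b _ /=.
exact: mulg1.
Qed.

Fact qmulVg : left_inverse (class W1) qinv qmul.
Proof.
move=> x; have [u ->] := class_surj x; rewrite qinvE qmulE; apply: class_eval => H a b _ /=.
exact: mulVg.
Qed.

Fact qmulgV : right_inverse (class W1) qinv qmul.
Proof.
move=> x; have [u ->] := class_surj x; rewrite qinvE qmulE; apply: class_eval => H a b _ /=.
exact: mulgV.
Qed.

HB.instance Definition _ := isGroup.Build Q qmulA qmul1g qmulg1 qmulVg qmulgV.

Lemma class_weval u : class u = weval (class Wa) (class Wb) u.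
Proof.
elim: u => //= [u <-|u <- v <-]; first by rewrite -qinvE.
by rewrite -qmulE.
Qed.

Lemma quotient_centreless : centreless (class Wa) (class Wb).
Proof.
move=> g; have [u ->] := class_surj g => cua cub.
have Z w : commute (class u) (class w) -> hypercentral (Wcomm u w).
  move=> cuw; have /classP : class W1 = class (Wcomm u w).
    rewrite [RHS]class_weval /= -!class_weval.
    by rewrite cuw mulKg mulVg.
  by apply: hypercentral_eq => H a b _ /=; rewrite invg1 mul1g.
apply/esym/classP; apply: hypercentral_eq (hypercentral_gen (Z _ cua) (Z _ cub)).
by move=> H a b _ /=; rewrite invg1 mul1g.
Qed.

Lemma quotient_rel (k l : int) :
  (forall (H : Group) (x : H), gpow H x alpha = zpow x k) ->
  (forall (H : Group) (x : H), gpow H x beta = zpow x l) ->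
  macdonald_rel (class Wa) (class Wb) k l.
Proof.
move=> ak bl; split.
  transitivity (class (Wconj Wa (Wcomm Wa Wb))); first by rewrite [RHS]class_weval.
  rewrite -(weval_z (class Wa) (class Wb) Wa) -class_weval.
  apply: class_eval => H a b [ra _]; rewrite weval_z /= -ak -ra conjE commE.
  by rewrite commgEl conjgE.
transitivity (class (Wconj Wb (Wcomm Wb Wa))); first by rewrite [RHS]class_weval.
rewrite -(weval_z (class Wa) (class Wb) Wb) -class_weval.
apply: class_eval => H a b [_ rb]; rewrite weval_z /= -bl -rb conjE commE.
by rewrite commgEl conjgE.
Qed.

End Hypercentral.

(* G(alpha,beta) is nilpotent (of some class c) iff every group generated by
   two elements satisfying the defining relations (i.e. every quotient of
   G(alpha,beta), including G(alpha,beta) itself) is nilpotent of class <= c,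
   with c uniform. *)
Theorem theorem3p1 (alpha beta : Z) :
  alpha <> 1%Z -> beta <> 1%Z ->
  exists c : nat, forall (H : Group) (a b : H),
    G_rels H alpha beta a b -> gen2_nilpotent_class_le H a b c.
Proof.
move=> alpha1 beta1.
have [k [k1 kE]] := gpowE alpha; have [l [l1 lE]] := gpowE beta.
(* Triviality of the quotient places both letters in finite levels i and j of the series, and the
   larger one bounds the class. *)
have [||/esym/classP[i Za] /esym/classP[j Zb]] :=
    macdonald_centreless _ _ (quotient_rel kE lE) (@quotient_centreless alpha beta).
- by apply/eqP => /k1.
- by apply/eqP => /l1.
exists (maxn i j) => H a b rel; apply: ucs_nilpotent.
  have := Za _ _ _ rel; rewrite /= invg1 mul1g; apply: ucs_le; exact: leq_maxl.
have := Zb _ _ _ rel; rewrite /= invg1 mul1g; apply: ucs_le; exact: leq_maxr.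
Qed.
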